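(* For any integer $k \geq 3$ and infinitely many values of $n$, there exist $n$-vertex graphs $G$ with \[ \operatorname{pn}_\ell(G) \leq \operatorname{pn}_u(G) \leq k+2 \quad \text{and} \quad \operatorname{pn}(G) = \Omega\left(\sqrt{k}\, n^{1/2-1/k}\right). \] In contrast, for every graph $G$ we have $\operatorname{pn}_u(G) \leq 4 \operatorname{pn}_\ell(G)+2$.
   Context: All graphs are finite and simple. A linear embedding of a graph $G=(V,E)$ is a pair $(\prec,\mathcal{P})$ where $\prec$ is a total ordering of $V$ (the spine ordering) and $\mathcal{P}$ is a partition of $E$ into parts called pages. Two edges $uv, xy$ with $u\prec v$, $x \prec y$ cross if $u \prec x \prec v \prec y$ or $x \prec u \prec y \prec v$. A book embedding is a linear embedding in which no two crossing edges lie on the same page. The page number $\operatorname{pn}(G)$ is the minimum number of pages of a book embedding of $G$. For a book embedding and a vertex $v$, let $\mathcal{P}_v$ be the set of pages containing at least one edge incident to $v$; the embedding is $k$-local if $|\mathcal{P}_v| \le k$ for all $v$, and the local page number $\operatorname{pn}_\ell(G)$ is the smallest $k$ such that $G$ has a $k$-local book embedding (with any number of pages). For a linear embedding and page $P$, let $G_P$ be the subgraph of $G$ consisting of the edges in $P$ and all vertices incident to some edge of $P$. A union embedding is a linear embedding such that for every page $P$ and every connected component $C$ of $G_P$, no two edges of $C$ cross. The union page number $\operatorname{pn}_u(G)$ is the smallest number of pages of a union embedding of $G$. The $\Omega$ refers to asymptotics as $n \to \infty$. *)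

(* Defs.v *)
From mathcomp Require Import all_boot all_fingroup.
From mathcomp Require Import boolp.
Set Implicit Arguments. Unset Strict Implicit. Unset Printing Implicit Defensive.

(* A simple graph on n vertices: vertex set 'I_n, adjacency adj : rel 'I_n
   (assumed symmetric and irreflexive where needed).  An undirected edge {u,v}
   is represented by both ordered pairs (u,v) and (v,u).

   A linear embedding with m pages: a spine ordering given by a permutation
   p (u precedes v iff p u < p v), and a page assignment
   pg : 'I_n * 'I_n -> 'I_m which is consistent on the two orientations of
   every edge (so that it defines a partition of E into m parts; parts may be
   empty, which does not affect any of the minima below). *)

Section Embeddings.
Variable n : nat.
Variable adj : rel 'I_n.

Definition is_linear m (pg : {ffun 'I_n * 'I_n -> 'I_m}) : Prop :=
  forall u v, adj u v -> pg (u, v) = pg (v, u).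

Definition cross (p : {perm 'I_n}) (u v x y : 'I_n) : bool :=
  [&& p u < p v, p x < p y &
      [&& p u < p x, p x < p v & p v < p y] ||
      [&& p x < p u, p u < p y & p y < p v]].

Definition is_book m (p : {perm 'I_n}) (pg : {ffun 'I_n * 'I_n -> 'I_m}) : Prop :=
  is_linear pg /\
  forall u v x y, adj u v -> adj x y -> cross p u v x y -> pg (u, v) <> pg (x, y).

(* the graph G_P of page P, as a relation; its connected components are the
   classes of connect (page_rel pg P) among vertices incident to P *)
Definition page_rel m (pg : {ffun 'I_n * 'I_n -> 'I_m}) (P : 'I_m) : rel 'I_n :=
  fun a b => adj a b && (pg (a, b) == P).

Definition is_union m (p : {perm 'I_n}) (pg : {ffun 'I_n * 'I_n -> 'I_m}) : Prop :=
  is_linear pg /\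
  forall u v x y, adj u v -> adj x y -> cross p u v x y ->
    pg (u, v) = pg (x, y) -> ~ connect (page_rel pg (pg (u, v))) u x.

Definition is_local m (k : nat) (pg : {ffun 'I_n * 'I_n -> 'I_m}) : Prop :=
  forall v, #|[set pg (v, w) | w : 'I_n & adj v w]| <= k.

Definition has_book (m : nat) : Prop :=
  exists (p : {perm 'I_n}) (pg : {ffun 'I_n * 'I_n -> 'I_m}), is_book p pg.

Definition has_union (m : nat) : Prop :=
  exists (p : {perm 'I_n}) (pg : {ffun 'I_n * 'I_n -> 'I_m}), is_union p pg.

Definition has_local (k : nat) : Prop :=
  exists m (p : {perm 'I_n}) (pg : {ffun 'I_n * 'I_n -> 'I_m}),
    is_book p pg /\ is_local k pg.

Lemma card_pairs : #|{: 'I_n * 'I_n}| = n * n.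
Proof. by rewrite card_prod card_ord. Qed.

Definition key (e : 'I_n * 'I_n) : 'I_n * 'I_n :=
  if e.1 < e.2 then e else (e.2, e.1).

Definition own_page : {ffun 'I_n * 'I_n -> 'I_(n * n)} :=
  [ffun e => cast_ord card_pairs (enum_rank (key e))].

Lemma own_page_book : is_book (1%g : {perm 'I_n}) own_page.
Proof.
split.
  move=> u v _; rewrite !ffunE /key /=.
  case: (ltngtP u v) => // /val_inj -> //.
move=> u v x y _ _; rewrite /cross !perm1 => /and3P[uv xy H].
rewrite !ffunE /key /= uv xy => /cast_ord_inj /enum_rank_inj [ux _].
by move: H; rewrite ux ltnn.
Qed.

Lemma has_book_ex : exists m, `[< has_book m >].
Proof. by exists (n * n); apply/asboolP; exists 1%g, own_page; exact: own_page_book. Qed.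

Lemma has_union_ex : exists m, `[< has_union m >].
Proof.
exists (n * n); apply/asboolP; exists 1%g, own_page.
have [H1 H2] := own_page_book; split => // u v x y a b c d.
by have := H2 u v x y a b c.
Qed.

Lemma has_local_ex : exists k, `[< has_local k >].
Proof.
exists n; apply/asboolP; exists (n * n), 1%g, own_page; split.
  exact: own_page_book.
move=> v; apply: leq_trans (leq_imset_card _ _) _.
by rewrite -[n in _ <= n]card_ord max_card.
Qed.

Definition pn : nat := ex_minn has_book_ex.
Definition pn_u : nat := ex_minn has_union_ex.
Definition pn_l : nat := ex_minn has_local_ex.

End Embeddings.

(* Main.v *)
(* Lower bound: take d = k + 2 functions F_t from A to B, with |A| = |B| = t^2, and join a to
   every F_t(a).  Each F_t contributes a star forest, and a star never crosses itself, so
   pn_u <= d.  Cut the spine into 2t blocks of size t.  In a book embedding the pairs of blocks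
   joined on one page do not cross, so there are O(t) of them per page: m pages use a set S of
   O(t m) block pairs.  For given blocks and S, AM-GM bounds the number of F compatible with S
   by (O(m / t) |B|)^(d |A|), and there are only 2^(O(t^2)) t^(2 t^2) choices of blocks and S;
   hence some F needs about t^(1 - 2/d) pages, and n = 2 t^2.  The exponent for d = k + 2 is
   larger than the one for k, which absorbs the factor sqrt k and all constants.

   Upper bound: in a noncrossing page, an edge ij with i before j is the leftmost edge of j or
   the rightmost edge of i.  So in a k-local book embedding, where every vertex numbers its own
   pages by slots below k, each edge is the leftmost or rightmost edge of an endpoint in a
   certain slot.  Fixing the slot and the side gives a forest, since parents always lie on the
   same side; splitting its edges by the parity of the depth of the child leaves stars. *)

From mathcomp Require Import order ssralg ssrnum ssrint.
From mathcomp Require Import boolp zify.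
From Stdlib Require Import Reals Lra.
Require Import Defs.
From mathcomp Require Import all_boot all_fingroup.
Set Implicit Arguments. Unset Strict Implicit. Unset Printing Implicit Defensive.
(* MathComp binds the key [%R] to [ring_scope]. *)
Delimit Scope R_scope with R.

(** * Union embeddings: star pages and splitting into components *)

(** [ctr P] is constant on each component of page [P] and is an end of each edge there, so two edges
    of one component share a vertex and cannot cross. *)
Lemma union_of_stars n (adj : rel 'I_n) m (p : {perm 'I_n})
    (pg : {ffun 'I_n * 'I_n -> 'I_m}) (ctr : 'I_m -> 'I_n -> 'I_n) :
  is_linear adj pg ->
  (forall u v, adj u v -> let c := ctr (pg (u, v)) in
     c u = c v /\ (c u = u \/ c u = v)) ->
  is_union adj p pg.
Proof.
move=> lin star; split=> // u v x y uv xy crs eP.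
have conn_ctr a b : connect (page_rel adj pg (pg (u, v))) a b ->
    ctr (pg (u, v)) a = ctr (pg (u, v)) b.
  case/connectP=> q; elim: q a => [|z q IH] a /= => [_ -> //|].
  case/andP=> /andP[az /eqP Paz] zq bE.
  by have [azE _] := star _ _ az; rewrite -(IH z zq bE) -Paz.
move=> /conn_ctr ux.
have [_ uE] := star _ _ uv; have [_ xE] := star _ _ xy.
rewrite -eP -ux in xE; move: crs; rewrite /cross.
by case: uE xE => -> [] <-; lia.
Qed.

(** Giving each component of each page its own page yields a book embedding, in which a vertex meets
    at most one new page per old page. *)
Lemma pn_l_le_pn_u n (adj : rel 'I_n) : symmetric adj -> pn_l adj <= pn_u adj.
Proof.
move=> sym; rewrite /pn_u; case: ex_minnP => m /asboolP[p [pg [lin uni]]] _.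
rewrite /pn_l; case: ex_minnP => k _; apply; apply/asboolP.
pose R P := page_rel adj pg P.
have csym P : connect_sym (R P).
  apply: sym_connect_sym => a b; rewrite /R /page_rel sym.
  by case ba: (adj b a); rewrite //= (lin _ _ ba).
pose comp e := (pg e, root (R (pg e)) e.1).
exists #|{: 'I_m * 'I_n}|, p, [ffun e => enum_rank (comp e)]; split; first split.
- move=> u v uv; rewrite !ffunE /comp -(lin _ _ uv); congr (enum_rank (_, _)).
  by apply/(rootP (csym _))/connect1; rewrite /R /page_rel uv eqxx.
- move=> u v x y uv xy crs; rewrite !ffunE => /enum_rank_inj[eP].
  rewrite -eP => /(rootP (csym _)); exact: (uni u v x y).
- move=> v; have := leq_imset_card (fun P => enum_rank (P, root (R P) v)) [set: 'I_m].
  rewrite cardsT card_ord; apply: leq_trans.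
  apply/subset_leq_card/subsetP=> Q /imsetP[w _ ->]; rewrite ffunE.
  by apply/imsetP; exists (pg (v, w)).
Qed.

(** * Depth parity in a rooted forest *)

Section Alternate.
Variables (T : Type) (f : T -> T) (r : T -> nat).

(** Parity of the depth of [x], a root being a point where [f] fails to lower [r]; fuel above [r x]
    never runs out. *)
Fixpoint alternate fuel x :=
  if fuel is fuel'.+1 then (r (f x) < r x) && ~~ alternate fuel' (f x) else false.

Lemma alternate_fuel i j x : r x < i -> r x < j -> alternate i x = alternate j x.
Proof.
elim: i j x => [|i IH] [|j] x //= xi xj.
by case: ltnP => //= fx; congr negb; apply: IH; lia.
Qed.

Definition depth_parity x := alternate (r x).+1 x.

Lemma depth_parityE x : r (f x) < r x -> depth_parity x = ~~ depth_parity (f x).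
Proof. by move=> fx; rewrite /depth_parity /= fx (@alternate_fuel _ (r (f x)).+1). Qed.

End Alternate.

(** * From a local book embedding to star pages *)

Section LocalToUnion.
Variables (n : nat) (adj : rel 'I_n) (m k : nat).
Variables (p : {perm 'I_n}) (pg : {ffun 'I_n * 'I_n -> 'I_m}).
Hypotheses (sym : symmetric adj) (irr : irreflexive adj).
Hypotheses (book : is_book adj p pg) (loc : is_local adj k pg).

Let pgC u v : adj u v -> pg (u, v) = pg (v, u). Proof. exact: book.1. Qed.

(** Reversing the spine for [s = true] lets one argument treat leftmost and rightmost edges
    alike. *)
Definition rank (s : bool) v : 'I_n := if s then rev_ord (p v) else p v.

Definition extreme s v u :=
  [&& adj v u, rank s u < rank s v &
      [forall w, adj v w && (pg (v, w) == pg (v, u)) ==> (rank s u <= rank s w)]].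

Lemma rank_inj s : injective (rank s).
Proof. by case: s => u v; [move=> /rev_ord_inj|]; apply: perm_inj. Qed.

Lemma extreme_uniq s v u w :
  extreme s v u -> extreme s v w -> pg (v, u) = pg (v, w) -> u = w.
Proof.
case/and3P=> vu _ /forallP/(_ w) uw /and3P[vw _ /forallP/(_ u) wu] eP.
rewrite vw eP eqxx /= in uw; rewrite vu eP eqxx /= in wu.
by apply/(@rank_inj s)/val_inj/eqP; rewrite /= eqn_leq uw wu.
Qed.

Lemma extremeP s v u : adj v u -> rank s u < rank s v -> ~~ extreme s v u ->
  exists2 w, adj v w /\ pg (v, w) = pg (v, u) & rank s w < rank s u.
Proof.
rewrite /extreme => -> -> /=; rewrite negb_forall => /existsP[w].
rewrite negb_imply -ltnNge => /andP[/andP[vw /eqP eP] wu]; by exists w.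
Qed.

(* Otherwise [uv] is nested strictly between two edges of its page at [u] and [v], which cross. *)
Lemma edge_extreme u v : adj u v -> p u < p v -> extreme false v u || extreme true u v.
Proof.
move=> uv lt_uv; apply/norP => -[].
have vu : adj v u by rewrite sym.
have lt_r : rank true v < rank true u by rewrite /rank /=; have := ltn_ord (p v); lia.
case/(@extremeP false _ _ vu lt_uv)=> w [vw ePw] wu; case/(extremeP uv lt_r)=> x [ux ePx].
rewrite /rank /= in wu * => xv.
have {}xv : p v < p x by have := ltn_ord (p v); lia.
have wv : adj w v by rewrite sym.
case: book => _ /(_ w v u x wv ux); apply; first by rewrite /cross; lia.
by rewrite (pgC wv) ePw ePx pgC.
Qed.

(** Numbering pages locally at [v] makes the number of forests depend on [k] instead of [m]. *)
Definition slot v P := index P (enum [set pg (v, w) | w : 'I_n & adj v w]).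

Lemma page_in_slots v w : adj v w -> pg (v, w) \in enum [set pg (v, w) | w : 'I_n & adj v w].
Proof. by move=> vw; rewrite mem_enum; apply: imset_f; rewrite inE. Qed.

Lemma slot_lt v w : adj v w -> slot v (pg (v, w)) < k.
Proof.
by move=> vw; apply: leq_trans (loc v); rewrite /slot [leqRHS]cardE index_mem page_in_slots.
Qed.

Lemma slot_inj v u w : adj v u -> adj v w ->
  slot v (pg (v, u)) = slot v (pg (v, w)) -> pg (v, u) = pg (v, w).
Proof. move=> vu vw eS; rewrite -[LHS](nth_index (pg (v, u)) (page_in_slots vu)).
by rewrite -[RHS](nth_index (pg (v, u)) (page_in_slots vw)) -/(slot _ _) eS. Qed.

(** The default [v] does not lower the rank, so [depth_parity] sees a vertex without parent as a
    root. *)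
Definition parent s c v : 'I_n :=
  odflt v [pick u | extreme s v u && (slot v (pg (v, u)) == c)].

Lemma parentE s v u : extreme s v u -> parent s (slot v (pg (v, u))) v = u.
Proof.
move=> vu; rewrite /parent; case: pickP => [w /andP[vw /eqP eS] /=|/(_ u)]; last by rewrite vu eqxx.
have [[adj_vw _ _] [adj_vu _ _]] := (and3P vw, and3P vu).
exact: (extreme_uniq vw vu (slot_inj adj_vw adj_vu eS)).
Qed.

Definition parity s c := depth_parity (parent s c) (rank s).

Definition star_page (s : bool) v P := 4 * slot v P + 2 * s + parity s (slot v P) v.

(** The default [0] never occurs on an edge, since [edge_extreme] makes one of the tests succeed. *)
Definition union_page u v :=
  let P := pg (u, v) in
  if extreme false u v then star_page false u P
  else if extreme false v u then star_page false v P
  else if extreme true u v then star_page true u P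
  else if extreme true v u then star_page true v P else 0.

(** Decodes [star_page]: vertices of the recorded parity are leaves attached to their parents, the
    others are centres. *)
Definition center (Q : nat) v :=
  let s := odd Q./2 in let c := Q %/ 4 in
  if parity s c v == odd Q then parent s c v else v.

Lemma extreme_asym s u v : extreme s u v -> extreme s v u = false.
Proof. by case/and3P=> _ uv _; rewrite /extreme ltnNge (ltnW uv) andbF. Qed.

Lemma union_pageC u v : adj u v -> union_page u v = union_page v u.
Proof.
move=> uv; rewrite /union_page -(pgC uv).
case: (boolP (extreme false u v)) => [/extreme_asym -> //|_] /=.
by case: ifP => // _; case: (boolP (extreme true u v)) => [/extreme_asym -> //|_] /=; case: ifP.
Qed.

Lemma union_pageP u v : adj u v -> exists s x y,
  [/\ (x = u /\ y = v) \/ (x = v /\ y = u), extreme s x y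
    & union_page u v = star_page s x (pg (x, y))].
Proof.
move=> uv; have ePuv := pgC uv; rewrite /union_page /=.
case: ifP => [E|E1]; first by exists false, u, v; split; [left| |].
case: ifP => [E|E2]; first by exists false, v, u; rewrite -ePuv; split; [right| |].
case: ifP => [E|E3]; first by exists true, u, v; split; [left| |].
case: ifP => [E|E4]; first by exists true, v, u; rewrite -ePuv; split; [right| |].
case: (ltngtP (p u) (p v)) => [lt|lt|/val_inj/perm_inj euv].
- by have := edge_extreme uv lt; rewrite E2 E3.
- by rewrite sym in uv; have := edge_extreme uv lt; rewrite E1 E4.
- by rewrite euv irr in uv.
Qed.

Lemma center_star s v u : extreme s v u ->
  let c := center (star_page s v (pg (v, u))) in c v = u /\ c u = u.
Proof.
move=> vu; set P := pg (v, u); rewrite /center /star_page /=.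
set b := parity s (slot v P) v.
have -> : odd (4 * slot v P + 2 * s + b)./2 = s by case: s b {vu} => -[]; lia.
have -> : odd (4 * slot v P + 2 * s + b) = b by case: s b {vu} => -[]; lia.
have -> : (4 * slot v P + 2 * s + b) %/ 4 = slot v P by case: s b {vu} => -[]; lia.
rewrite eqxx parentE //; split=> //.
have bE : b = ~~ parity s (slot v P) u.
  rewrite /b /parity depth_parityE parentE //.
  by case/and3P: vu.
by rewrite bE; case: parity.
Qed.

End LocalToUnion.

Lemma pn_u_le_pn_l n (adj : rel 'I_n) : symmetric adj -> irreflexive adj ->
  pn_u adj <= 4 * pn_l adj + 2.
Proof.
move=> sym irr; rewrite /pn_l; case: ex_minnP => k /asboolP[m [p [pg [book loc]]]] _.
(* [inord] requires the number of pages to be a successor; edges receive pages below [4 * k]. *)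
rewrite /pn_u; case: ex_minnP => k' _; apply; apply/asboolP; rewrite addn2.
exists p, [ffun e => inord (union_page adj p pg e.1 e.2)].
apply: (@union_of_stars _ _ _ _ _ (fun Q => center adj p pg Q)) => [u v uv|u v uv /=].
  by rewrite !ffunE /= (union_pageC book).
rewrite ffunE /=.
have [s [x [y [xy ex ->]]]] := union_pageP sym irr book uv.
rewrite inordK.
  by have [] := center_star ex; case: xy => -[-> ->] -> ->; auto.
have : adj x y by case/and3P: ex.
by move/(slot_lt loc); rewrite /star_page; case: s {ex} => /=; case: parity => /=; lia.
Qed.

(** * Block pairs in book embeddings *)

(** A pair that is neither the leftmost at its right end ([T1]) nor the rightmost at its left end
    ([T2]) would yield two crossing pairs; each of [T1] and [T2] is determined by one end. *)
Lemma card_noncrossing b (T : {set 'I_b * 'I_b}) :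
  (forall e, e \in T -> e.1 < e.2) ->
  (forall e e' : 'I_b * 'I_b, e \in T -> e' \in T ->
     e.1 < e'.1 -> e'.1 < e.2 -> e.2 < e'.2 -> False) ->
  #|T| <= 2 * b.
Proof.
move=> lt nc.
pose T1 := [set e in T | [forall e' in T, (e'.2 == e.2) ==> (e.1 <= e'.1)]].
pose T2 := [set e in T | [forall e' in T, (e'.1 == e.1) ==> (e'.2 <= e.2)]].
have T12 : T \subset T1 :|: T2.
  apply/subsetP=> e eT; rewrite !inE eT /= -[_ || _]negbK negb_or.
  apply/negP=> /andP[/forall_inPn[x xT]]; rewrite negb_imply -ltnNge => /andP[/eqP x2 x1].
  case/forall_inPn=> y yT; rewrite negb_imply -ltnNge => /andP[/eqP y1 y2].
  by apply: (nc x y xT yT); rewrite ?x2 ?y1 // lt.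
have c1 : #|T1| <= b.
  rewrite -[b in _ <= b]card_ord -(@card_in_imset _ _ snd) ?max_card //.
  move=> [i j] [i' j']; rewrite !inE /= => /andP[eT /forall_inP E] /andP[eT' /forall_inP E'] ej.
  have := E _ eT'; have := E' _ eT; rewrite -ej eqxx /= => l1 l2.
  by congr (_, _); apply/val_inj/eqP; rewrite /= eqn_leq l1 l2.
have c2 : #|T2| <= b.
  rewrite -[b in _ <= b]card_ord -(@card_in_imset _ _ fst) ?max_card //.
  move=> [i j] [i' j']; rewrite !inE /= => /andP[eT /forall_inP E] /andP[eT' /forall_inP E'] ej.
  have := E _ eT'; have := E' _ eT; rewrite -ej eqxx /= => l1 l2.
  by congr (_, _); apply/val_inj/eqP; rewrite /= eqn_leq l1 l2.
by have := subset_leq_card T12; have := (leq_card_setU T1 T2).1; lia.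
Qed.

(** Edges joining interleaved block pairs cross, so each page gives at most [2 * b] pairs in each
    direction; the [b] diagonal pairs are counted once. *)
Lemma card_block_pairs n (adj : rel 'I_n) m (p : {perm 'I_n})
    (pg : {ffun 'I_n * 'I_n -> 'I_m}) b (blk : 'I_n -> 'I_b) :
  symmetric adj -> is_book adj p pg ->
  (forall u v, blk u < blk v -> p u < p v) ->
  #|[set e : 'I_b * 'I_b | [exists u, exists v,
       [&& adj u v, blk u == e.1 & blk v == e.2]]]| <= b + m * (4 * b).
Proof.
move=> sym [lin nc] mono; set S := [set _ | _].
pose T P := [set e : 'I_b * 'I_b | (e.1 < e.2) && [exists u, exists v,
  [&& adj u v, pg (u, v) == P, blk u == e.1 & blk v == e.2]]].
pose swap (e : 'I_b * 'I_b) := (e.2, e.1).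
pose D := [set (i, i) | i : 'I_b].
have cT P : #|T P| <= 2 * b.
  apply: card_noncrossing => [e|e e']; first by rewrite inE => /andP[].
  rewrite !inE => /andP[_ /existsP[u /existsP[v /and4P[uv /eqP Puv /eqP <- /eqP <-]]]].
  case/andP=> _ /existsP[x /existsP[y /and4P[xy /eqP Pxy /eqP <- /eqP <-]]].
  move=> /mono ux /mono xv /mono vy; apply: (nc u v x y) => //; last by rewrite Puv Pxy.
  by rewrite /cross; lia.
have cU P : #|T P :|: swap @: T P| <= 4 * b.
  apply: leq_trans (leq_card_setU _ _).1 _.
  by have := leq_imset_card swap (T P); have := cT P; lia.
have sub : S \subset D :|: \bigcup_P (T P :|: swap @: T P).
  apply/subsetP=> -[i j]; rewrite inE /= => /existsP[u /existsP[v /and3P[uv /eqP eu /eqP ev]]].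
  rewrite inE; case: (ltngtP i j) => [lt|gt|/val_inj eij].
  - apply/orP; right; apply/bigcupP; exists (pg (u, v)) => //; rewrite !inE /= lt.
    by apply/orP; left; apply/existsP; exists u; apply/existsP; exists v; rewrite uv eu ev !eqxx.
  - apply/orP; right; apply/bigcupP; exists (pg (u, v)) => //; rewrite inE.
    apply/orP; right; apply/imsetP; exists (j, i) => //; rewrite inE /= gt /=.
    apply/existsP; exists v; apply/existsP; exists u.
    by rewrite sym (lin _ _ uv) uv eu ev !eqxx.
  - by apply/orP; left; apply/imsetP; exists i; rewrite // eij.
apply: leq_trans (subset_leq_card sub) _; apply: leq_trans (leq_card_setU _ _).1 _.
apply: leq_add; first by have := leq_imset_card (fun i : 'I_b => (i, i)) 'I_b; rewrite card_ord.
have -> : m * (4 * b) = \sum_(P < m) 4 * b by rewrite sum_nat_const card_ord.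
elim/big_ind2: _ => [|s1 i1 s2 i2 h1 h2|//]; first by rewrite cards0.
by apply: leq_trans (leq_card_setU _ _).1 _; apply: leq_add.
Qed.


(** * Counting functions by AM-GM *)

Lemma prod_AGM (I : finType) (E : I -> nat) :
  #|I| ^ #|I| * \prod_i E i <= (\sum_i E i) ^ #|I|.
Proof.
have [] := @Num.Theory.leif_AGM_scaled int I predT (fun i => GRing.natmul (GRing.one int) (E i)) => [i _|].
  by rewrite Num.Theory.mulrn_wge0 ?Num.Theory.ler0n.
rewrite -GRing.Theory.natr_sum -GRing.Theory.natrX => le _; rewrite -(Num.Theory.ler_nat int); apply: Order.POrderTheory.le_trans le.
rewrite -prod_nat_const -big_split /= GRing.Theory.natr_prod.
by under [X in Order.le _ X]eq_bigr do rewrite -GRing.Theory.mulrnA mulnC.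
Qed.

(** Double counting: each element of [S] is the image of at most [s * s] pairs. *)
Lemma card_bounded_fibres (A B C : finType) (f : A -> C) (g : B -> C)
    (S : {set C * C}) s :
  (forall c, #|[set a | f a == c]| <= s) -> (forall c, #|[set a | g a == c]| <= s) ->
  \sum_a #|[set y | (f a, g y) \in S]| <= #|S| * s ^ 2.
Proof.
move=> fs gs.
have -> : \sum_a #|[set y | (f a, g y) \in S]| = #|[set e : A * B | (f e.1, g e.2) \in S]|.
  rewrite -sum1dep_card -(pair_big_dep predT (fun a y => (f a, g y) \in S) (fun _ _ => 1)) /=.
  by apply: eq_bigr => a _; rewrite sum1dep_card.
rewrite -sum1dep_card (partition_big (fun e => (f e.1, g e.2)) (mem S)) //=.
rewrite -sum_nat_const; apply: leq_sum => -[c c'] _; rewrite sum1dep_card.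
apply: leq_trans (leq_mul (fs c) (gs c')); rewrite -cardsX.
by apply/subset_leq_card/subsetP=> -[a y]; rewrite !inE /= => /andP[_ /eqP[-> ->]]; rewrite !eqxx.
Qed.

(* First-moment count: each pair of block maps and admissible set [S] accounts, by AM-GM,
   for at most [(M * s ^ 2 / #|A|) ^ #|D * A|] of the [#|B| ^ #|D * A|] functions. *)
Lemma count_block_confined (D A B C : finType) s M :
  0 < #|D| -> 0 < #|A| ->
  (forall F : {ffun D * A -> B},
     exists (f : {ffun A -> C}) (g : {ffun B -> C}) (S : {set C * C}),
     [/\ forall c, #|[set a | f a == c]| <= s, forall c, #|[set a | g a == c]| <= s,
         #|S| <= M & forall t a, (f a, g (F (t, a))) \in S]) ->
  (#|A| * #|B|) ^ (#|D| * #|A|) <=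
    #|C| ^ #|A| * #|C| ^ #|B| * 2 ^ (#|C| * #|C|) * (M * s ^ 2) ^ (#|D| * #|A|).
Proof.
move=> D0 A0 confined.
pose X := ({ffun A -> C} * {ffun B -> C} * {set C * C})%type.
pose good (x : X) := [&& [forall c, #|[set a | x.1.1 a == c]| <= s],
  [forall c, #|[set a | x.1.2 a == c]| <= s] & #|x.2| <= M].
pose Y (x : X) (e : D * A) := [set y | (x.1.1 e.2, x.1.2 y) \in x.2].
pose fam (x : X) := [set F : {ffun D * A -> B} | F \in family (Y x)].
set N := #|D| * #|A|.
have cDA : #|{: D * A}| = N by rewrite card_prod.
have cfam x : good x -> #|A| ^ N * #|fam x| <= (M * s ^ 2) ^ N.
  case/and3P=> /forallP fs /forallP gs SM.
  (* AM-GM runs over all of [D * A]. The factor [#|D| ^ N] turns [#|A| ^ N] into the power it needs,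
     and cancels because [Y x] ignores the [D] coordinate. *)
  have D0' : 0 < #|D| ^ N by rewrite expn_gt0 D0.
  rewrite -(leq_pmul2l D0') mulnA -!expnMn -/N cardsE card_family.
  have -> : foldr muln 1 [seq #|Y x e| | e : D * A] = \prod_(e : D * A) #|Y x e|.
    by rewrite foldrE big_map big_enum.
  rewrite -{1}cDA -[in X in _ ^ X]cDA; apply: leq_trans (prod_AGM _) _.
  rewrite cDA leq_exp2r ?muln_gt0 ?D0 //.
  rewrite -(pair_bigA _ (fun (_ : D) a => #|[set y | (x.1.1 a, x.1.2 y) \in x.2]|)) /=.
  rewrite sum_nat_const leq_mul2l.
  apply/orP; right; apply: leq_trans (card_bounded_fibres _ _ _) _; [exact: fs | exact: gs |].
  by rewrite leq_mul2r SM orbT.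
have cov : [set: {ffun D * A -> B}] \subset \bigcup_(x | good x) fam x.
  apply/subsetP=> F _; have [f [g [S [fs gs SM FS]]]] := confined F.
  apply/bigcupP; exists (f, g, S); first by apply/and3P; split=> //; apply/forallP.
  by rewrite inE; apply/familyP=> -[t a]; rewrite inE.
have := subset_leq_card cov; rewrite cardsT card_ffun cDA => leB.
have cbig : #|\bigcup_(x | good x) fam x| <= \sum_(x | good x) #|fam x|.
  elim/big_ind2: _ => [|s1 i1 s2 i2 h1 h2|//]; first by rewrite cards0.
  by apply: leq_trans (leq_card_setU _ _).1 _; apply: leq_add.
rewrite expnMn; apply: leq_trans (_ : #|A| ^ N * \sum_(x | good x) #|fam x| <= _).
  by rewrite leq_mul2l (leq_trans leB cbig) orbT.
rewrite big_distrr /=; apply: (@leq_trans (\sum_(x | good x) (M * s ^ 2) ^ N)); first exact: leq_sum.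
rewrite sum_nat_const leq_mul2r; apply/orP; right.
apply: leq_trans (max_card _) _.
have card_sets : #|{: {set C * C}}| = 2 ^ (#|C| * #|C|).
  by rewrite -card_prod -(cardsT (C * C)%type) -card_powerset powersetT cardsT.
by rewrite !card_prod card_sets !card_ffun.
Qed.

(** * Graphs built from functions *)

Section StarGraph.
Variables (h d : nat) (F : {ffun 'I_d.+1 * 'I_h -> 'I_h}).

Definition hits a y := [exists t, F (t, a) == y].

Definition star_adj : rel 'I_(h + h) := fun u v =>
  match split u, split v with
  | inl a, inr y | inr y, inl a => hits a y
  | _, _ => false
  end.

Lemma star_adj_sym : symmetric star_adj.
Proof. by move=> u v; rewrite /star_adj; case: (split u); case: (split v). Qed.

Lemma star_adj_irr : irreflexive star_adj.
Proof. by move=> u; rewrite /star_adj; case: (split u). Qed.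

Lemma star_adj_shift t a : star_adj (lshift h a) (rshift h (F (t, a))).
Proof.
rewrite /star_adj (unsplitK (inl a)) (unsplitK (inr (F (t, a)))).
by apply/existsP; exists t.
Qed.

Definition hit_index a y := odflt ord0 [pick t | F (t, a) == y].

Lemma hit_indexP a y : hits a y -> F (hit_index a y, a) = y.
Proof.
by case/existsP=> t e; rewrite /hit_index; case: pickP => [? /eqP //|/(_ t)]; rewrite e.
Qed.

(** On page [t] a left vertex [a] has at most the edge to [F (t, a)], so the page is a union of
    stars centred on the right. *)
Lemma pn_u_star_adj : pn_u star_adj <= d.+1.
Proof.
rewrite /pn_u; case: ex_minnP => k _; apply; apply/asboolP.
pose pg (e : 'I_(h + h) * 'I_(h + h)) := match split e.1, split e.2 with
  | inl a, inr y | inr y, inl a => hit_index a y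
  | _, _ => ord0
  end.
exists 1%g, (finfun pg).
pose ctr (t : 'I_d.+1) u := if split u is inl a then rshift h (F (t, a)) else u.
apply: (@union_of_stars _ _ _ _ _ ctr) => u v; rewrite /star_adj !ffunE /pg /ctr /=.
  by case: (split u); case: (split v).
have := splitK u; have := splitK v.
case: (split u) => [a|y]; case: (split v) => [a'|y'] //= <- <- /hit_indexP ->; auto.
Qed.

End StarGraph.

Lemma card_div_fibre (A : finType) (q : A -> nat) t c : 0 < t -> injective q ->
  #|[set a | q a %/ t == c]| <= t.
Proof.
move=> t0 qinj; pose r a := Ordinal (ltn_pmod (q a) t0).
rewrite -[t in _ <= t]card_ord -(@card_in_imset _ _ r) ?max_card //.
move=> a a'; rewrite !inE => /eqP ea /eqP ea' /(congr1 val) /= er.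
by apply: qinj; rewrite (divn_eq (q a) t) (divn_eq (q a') t) ea ea' er.
Qed.

Lemma exists_star_adj_pn t d m : 0 < t -> 0 < m ->
  64 * t ^ 2 * (10 * m) ^ d.+1 < t ^ d.+1 ->
  exists F : {ffun 'I_d.+1 * 'I_(t * t) -> 'I_(t * t)}, m < pn (star_adj F).
Proof.
move=> t0 m0 big; apply/existsP; apply: contraLR big => /existsPn small; rewrite -leqNgt.
have tt0 : 0 < t * t by rewrite muln_gt0 t0.
have confined (F : {ffun 'I_d.+1 * 'I_(t * t) -> 'I_(t * t)}) :
  exists (f : {ffun 'I_(t * t) -> 'I_(2 * t)}) (g : {ffun 'I_(t * t) -> 'I_(2 * t)})
    (S : {set 'I_(2 * t) * 'I_(2 * t)}),
    [/\ forall c, #|[set a | f a == c]| <= t, forall c, #|[set a | g a == c]| <= t,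
        #|S| <= 10 * t * m & forall i a, (f a, g (F (i, a))) \in S].
  have := small F; rewrite -leqNgt /pn; case: ex_minnP => j /asboolP[p [pg book]] _ jm.
  have blk_lt v : p v %/ t < 2 * t by rewrite ltn_divLR // -mulnA mul2n -addnn ltn_ord.
  pose blk v := Ordinal (blk_lt v).
  pose f := [ffun a => blk (lshift (t * t) a)]; pose g := [ffun y => blk (rshift (t * t) y)].
  exists f, g, [set e | [exists u, exists v,
    [&& star_adj F u v, blk u == e.1 & blk v == e.2]]]; split.
  - move=> c; under eq_finset do rewrite ffunE.
    by apply: (@card_div_fibre _ (fun a => p (lshift (t * t) a))) => // a a' /val_inj/perm_inj/lshift_inj.
  - move=> c; under eq_finset do rewrite ffunE.
    by apply: (@card_div_fibre _ (fun a => p (rshift (t * t) a))) => // a a' /val_inj/perm_inj/rshift_inj.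
  (* With [2 * t] blocks the bound is [2 * t + 8 * t * j], at most [10 * t * m] since [j <= m] and
     [0 < m]. *)
  - apply: leq_trans (card_block_pairs (@star_adj_sym _ _ F) book _) _ => [u v /=|]; last by nia.
    by apply: contraTT; rewrite -!leqNgt => /leq_div2r ->.
  - move=> i a; rewrite inE !ffunE; apply/existsP; exists (lshift (t * t) a); apply/existsP.
    by exists (rshift (t * t) (F (i, a))); rewrite star_adj_shift !eqxx.
have := count_block_confined _ _ confined; rewrite !card_ord => /(_ isT tt0).
have -> : 2 * t * (2 * t) = 4 * (t * t) by lia.
(* All exponents are multiples of [t * t]. Taking that root leaves
   [(2 * t) * (2 * t) * 2 ^ 4 = 64 * t ^ 2] for the choices of blocks and [S]. *)
rewrite !(expnM _ _ (t * t)) -!expnMn leq_exp2r // => le.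
have : t ^ (3 * d.+1) * t ^ d.+1 <= t ^ (3 * d.+1) * (64 * t ^ 2 * (10 * m) ^ d.+1).
  have -> : t ^ (3 * d.+1) * t ^ d.+1 = (t * t * (t * t)) ^ d.+1.
    by rewrite -expnD -mulSnr expnM; congr (_ ^ _); rewrite !expnS; lia.
  apply: leq_trans le _; have -> : 10 * t * m * t ^ 2 = t ^ 3 * (10 * m) by rewrite !expnS; lia.
  by rewrite expnMn -expnM; move: (t ^ (3 * d.+1)) (_ ^ d.+1) => X Y; rewrite !expnS expn0; lia.
by rewrite leq_pmul2l ?expn_gt0 ?t0.
Qed.

(** * Parameters and asymptotics *)

Lemma INR_expn a b : INR (a ^ b) = (INR a ^ b)%R.
Proof. by elim: b => [|b IH] //=; rewrite expnS mult_INR IH. Qed.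

Lemma sqrt_Rpower_le (k v : nat) : 3 <= k -> 640 * k <= v ->
  let t := v ^ (k * (k + 2)) in
  (sqrt (INR k) * Rpower (INR (t * t + t * t)) (/ 2 - / INR k) <= INR v ^ (k * k) / 640)%R.
Proof.
move=> k3 vk t.
have K3 : (3 <= INR k)%R by have := le_INR 3 k; rewrite /=; move=> H; have := H ltac:(lia); lra.
have Vk : (640 * INR k <= INR v)%R.
  by have := le_INR (640 * k) v ltac:(lia); rewrite mult_INR /=; lra.
set e := (_ - _)%R; set V := INR v in Vk *.
have V0 : (0 < V)%R by lra.
have kV : (0 < / INR k <= / 3)%R.
  by split; [apply: Rinv_0_lt_compat; lra | apply: Rinv_le_contravar; lra].
have nE : INR (t * t + t * t) = (2 * Rpower V (INR (2 * (k * (k + 2)))))%R.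
  rewrite Rpower_pow // plus_INR mult_INR INR_expn -/V mul2n -addnn pow_add; ring.
(* Since [2 * k * (k + 2) * e = (k + 2) * (k - 2)], a factor [V ^ 4] is left over to absorb
   [sqrt k], [Rpower 2 e] and [640]. *)
have eE : (INR (2 * (k * (k + 2))) * e = INR (k * k) + - INR 4)%R.
  by rewrite !mult_INR plus_INR /e /=; field; lra.
have powP : (0 < V ^ (k * k))%R by apply: pow_lt.
have pow2 : (Rpower 2 e <= 2)%R.
  rewrite -{2}(Rpower_1 2); last lra.
  by apply: Rle_Rpower; rewrite /e; lra.
have sq : (sqrt (INR k) <= INR k)%R.
  rewrite -{2}(sqrt_square (INR k)); last lra.
  by apply: sqrt_le_1; nra.
rewrite nE -Rpower_mult_distr; [|lra|exact: exp_pos].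
rewrite Rpower_mult eE Rpower_plus Rpower_Ropp !Rpower_pow //.
have V4 : (1280 * INR k <= V ^ 4)%R.
  have -> : (V ^ 4 = V * V * (V * V))%R by ring.
  have VV : (2 * V <= V * V)%R by nra.
  have : (1 * (2 * V) <= V * V * (V * V))%R by apply: Rmult_le_compat; lra.
  lra.
have iV : (0 < / V ^ 4)%R by apply/Rinv_0_lt_compat/pow_lt.
have sq0 := sqrt_pos (INR k).
have main : (sqrt (INR k) * Rpower 2 e <= V ^ 4 / 640)%R.
  apply: (Rle_trans _ (INR k * 2)); last by lra.
  apply: Rmult_le_compat => //; exact/Rlt_le/exp_pos.
apply: (Rle_trans _ (V ^ 4 / 640 * (V ^ (k * k) * / V ^ 4))).
  have pos : (0 <= V ^ (k * k) * / V ^ 4)%R by nra.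
  by have := Rmult_le_compat_r _ _ _ pos main; lra.
by right; field; lra.
Qed.

Theorem theorem1 :
  (exists c : R, (0 < c)%R /\
    forall k : nat, 3 <= k ->
    forall N : nat, exists n : nat, N <= n /\
      exists adj : rel 'I_n, symmetric adj /\ irreflexive adj /\
        pn_l adj <= pn_u adj /\ pn_u adj <= k + 2 /\
        (c * sqrt (INR k) * Rpower (INR n) (/ 2 - / INR k) <= INR (pn adj))%R)
  /\
  (forall (n : nat) (adj : rel 'I_n), symmetric adj -> irreflexive adj ->
     pn_u adj <= 4 * pn_l adj + 2).
Proof.
split; last exact: pn_u_le_pn_l.
exists 1%R; split=> [|k k3 N]; first lra.
(* These choices give [640 * m = v ^ (k * k)], hence [t ^ k = (640 * m) ^ (k + 2)], which exceeds
   [64 * (10 * m) ^ (k + 2)]; adding [N] makes the graph large. *)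
pose y := k + N; pose v := 640 * y; pose t := v ^ (k * (k + 2)).
pose m := y * v ^ (k * k).-1.
have y0 : 0 < y by rewrite /y; lia.
have v0 : 0 < v by rewrite /v; lia.
have t0 : 0 < t by rewrite expn_gt0 v0.
have m0 : 0 < m by rewrite muln_gt0 y0 expn_gt0 v0.
have vE : 640 * m = v ^ (k * k) by rewrite mulnA -expnS prednK // muln_gt0; lia.
have big : 64 * t ^ 2 * (10 * m) ^ k.+2 < t ^ k.+2.
  have -> : t ^ k.+2 = t ^ 2 * (64 ^ k.+2 * (10 * m) ^ k.+2).
    have -> : t ^ k.+2 = t ^ 2 * t ^ k by rewrite -expnD add2n.
    congr (_ * _); rewrite -expnMn mulnA vE -!expnM; congr (_ ^ _); lia.
  have t20 : 0 < t ^ 2 by rewrite muln_gt0 t0.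
  have m10 : 0 < (10 * m) ^ k.+2 by rewrite expn_gt0 muln_gt0 m0.
  rewrite -mulnA mulnCA (ltn_pmul2l t20) (ltn_pmul2r m10).
  by rewrite -{1}(expn1 64) ltn_exp2l.
have [F mF] := exists_star_adj_pn t0 m0 big.
exists (t * t + t * t); split.
  have : v <= t by rewrite -{1}(expn1 v) leq_pexp2l // muln_gt0; lia.
  by rewrite /v /y; nia.
exists (star_adj F); split; first exact: star_adj_sym.
split; first exact: star_adj_irr.
split; first exact/pn_l_le_pn_u/star_adj_sym.
split; first by rewrite addn2; exact: pn_u_star_adj.
rewrite Rmult_1_l; apply: Rle_trans (sqrt_Rpower_le k3 _) _; first by rewrite /v /y; lia.
have mV : (640 * INR m = INR v ^ (k * k))%R by rewrite -INR_expn -vE (mult_INR 640) (INR_IZR_INZ 640).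
have : (INR m <= INR (pn (star_adj F)))%R by apply: le_INR; lia.
lra.
Qed.
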